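(* Let $p>1$ and $q\in[1,p]$. For every non-increasing $g:(0,1]\to\mathbb{R}^+$ with $\int_0^1 g(u)\,du=f$ and every $\beta>0$, $$\int_0^1\left(\frac1t\int_0^t g(u)\,du\right)^p dt\ \le\ -\frac{q(\beta+1)}{(p-1)q\beta+(p-q)}\,f^p+\frac{p(\beta+1)^q}{(p-1)q\beta+(p-q)}\int_0^1\left(\frac1t\int_0^t g(u)\,du\right)^{p-q}g^q(t)\,dt .$$ Moreover, this inequality is sharp for every $\beta$ with $0<\beta\le\frac{1}{p-1}$: for any given $f>0$ and every $C>\frac{q(\beta+1)}{(p-1)q\beta+(p-q)}$ there is a non-increasing $g:(0,1]\to\mathbb{R}^+$ with $\int_0^1 g(u)\,du=f$ such that $$\int_0^1\left(\frac1t\int_0^t g(u)\,du\right)^p dt\ >\ -C f^p+\frac{p(\beta+1)^q}{(p-1)q\beta+(p-q)}\int_0^1\left(\frac1t\int_0^t g(u)\,du\right)^{p-q}g^q(t)\,dt .$$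
   Context: Here $\mathbb{R}^+$ denotes the non-negative reals, $f$ is a finite number, and integrals of non-negative functions are taken in $[0,+\infty]$ (the inequality is read in the extended sense if they are infinite). *)

(* Defs.v *)
From HB Require Import structures.
From mathcomp Require Import all_boot all_order all_algebra.
From mathcomp Require Import all_classical all_reals all_analysis.

Set Implicit Arguments.
Unset Strict Implicit.
Unset Printing Implicit Defensive.

Import Order.TTheory GRing.Theory Num.Theory.
Import numFieldNormedType.Exports.

Local Open Scope classical_set_scope.
Local Open Scope ring_scope.

(* A function on (0,1] is represented by g : R -> R, whose values outside
   `]0, 1] are irrelevant. *)
Definition admissible (R : realType) (f : R) (g : R -> R) : Prop :=
  [/\ forall t, t \in `]0, 1] -> 0 <= g t,
      forall s t, s \in `]0, 1] -> t \in `]0, 1] -> s <= t -> g t <= g s &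
      (\int[lebesgue_measure]_(u in `]0%R, 1%R]) (g u)%:E = f%:E)%E].

(* Real-valued integral (`fine` of the extended one): no information is lost
   for t in `]0, 1] when g is admissible, since the integral is then finite. *)
Definition average (R : realType) (g : R -> R) (t : R) : R :=
  t^-1 * \int[lebesgue_measure]_(u in `]0, t]) g u.

(* Main.v *)
Require Import Defs.
From HB Require Import structures.
From mathcomp Require Import all_boot all_order all_algebra.
From mathcomp Require Import all_classical all_reals all_analysis.
From mathcomp Require Import measurable_realfun.
From mathcomp Require Import ring lra.
Import Order.TTheory GRing.Theory Num.Theory.
Import numFieldNormedType.Exports.

(** Write A t for the average of g over (0, t], I for the integral of A^p,
    J for the integral of A^(p-q) g^q over (0, 1], and
    D = (p - 1) q beta + (p - q) > 0.

    The inequality.  If A comes from a continuously differentiable primitive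
    F, that is A = F / t, then t A^p has derivative
    p A^(p-1) F' - (p-1) A^p, so the integral of p A^(p-1) F' is
    f^p + (p - 1) I up to a boundary term at 0 ([integral_mean_powR]).  The
    tangent to y |-> y^q at y = 1, taken at y = (beta + 1) F' / A, bounds
    q (beta + 1) A^(p-1) F' by
    (beta + 1)^q A^(p-q) F'^q + (q - 1) A^p ([young_tangent]).  Combining the
    two gives D I + q (beta + 1) f^p <= p (beta + 1)^q J, which is the claim
    divided by D; [hardy_segment] is this computation on [a, 1].

    The primitive G of a monotone g need not be differentiable everywhere,
    and an unbounded g gives no direct control of the boundary term at 0.
    Both defects disappear when g is replaced by the difference quotient
    (G (t + h) - G t) / h.  It is continuous, bounded by f / h, and, because
    g is non-increasing, at most g; its primitive [smooth h g] lies between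
    G - G h and G.  Hence the right-hand side only grows when it is written
    with g instead of the quotient, and Fatou's lemma recovers I when h tends
    to 0 ([hardy_inequality_gt0]).

    Sharpness.  The tangent bound is an equality when g / A is constant and
    equal to 1 / (beta + 1), which happens for
    g t = f / (beta + 1) * t^(- beta / (beta + 1)).  When beta (p - 1) < 1
    this g makes I finite and turns the inequality into an equality, so any
    larger C gives a strict inequality.  When beta (p - 1) = 1 the integral
    diverges, and the same family with a parameter b < beta close to beta is
    used.  With x = (beta + 1) / (b + 1) the required inequality becomes
    (x^q - 1) / (x - 1) < C (p - 1); the left-hand side tends to q as x
    decreases to 1, while C (p - 1) > q ([tangent_slope_lt]). *)

Set Implicit Arguments.
Unset Strict Implicit.
Unset Printing Implicit Defensive.

Local Open Scope classical_set_scope.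
Local Open Scope ring_scope.

(** * Calculus and integration preliminaries *)

(** The tangent at 1 lies below the convex function y^q.  It is Young's
    inequality for the product y * 1 with exponents q and q / (q - 1). *)
Lemma bernoulli_powR (R : realType) (q y : R) : 1 <= q -> 0 <= y ->
  1 + q * (y - 1) <= y `^ q.
Proof.
rewrite le_eqVlt => /predU1P[<- y0|q1 y0]; first by rewrite powRr1//; lra.
have q0 : 0 < q by lra.
(* q / (q - 1) is the exponent conjugate to q *)
have q'0 : 0 < q / (q - 1) by rewrite divr_gt0//; lra.
have := @conjugate_powR R y 1 q (q / (q - 1)) y0 ler01 q0 q'0.
rewrite powR1 mulr1 invf_div => /(_ _)/wrap[|h].
  by field; lra.
suff : q * y <= q * (y `^ q / q + 1 * ((q - 1) / q)).
  rewrite mulrDr mulrCA divff ?mulr1; last lra.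
  by rewrite mul1r mulrCA divff ?mulr1; last lra; lra.
by rewrite ler_pM2l.
Qed.

Lemma FTC2_is_derive (R : realType) (F f : R -> R) (a b : R) : a < b ->
  (forall t, t \in `[a, b] -> is_derive t 1 F (f t)) ->
  (forall t, t \in `[a, b] -> {for t, continuous f}) ->
  (\int[lebesgue_measure]_(t in `[a, b]) (f t)%:E = (F b - F a)%:E)%E.
Proof.
move=> ab dF cf.
have cF t : t \in `[a, b] -> {for t, continuous F}.
  by move=> /dF [dFt _]; exact/differentiable_continuous/derivable1_diffP.
have aab : a \in `[a, b] by rewrite in_itv/= lexx ltW.
have bab : b \in `[a, b] by rewrite in_itv/= lexx ltW.
rewrite (@continuous_FTC2 _ f F)//.
- by apply: continuous_in_subspaceT => t /[1!inE] /cf.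
- split.
  + by move=> t /subset_itv_oo_cc /dF [].
  + exact/cvg_at_right_filter/cF.
  + exact/cvg_at_left_filter/cF.
- by move=> t /subset_itv_oo_cc /dF tF; rewrite derive1E derive_val.
Qed.

Lemma is_derive_mean_powR (R : realType) (F : R -> R) (df s t : R) :
  0 < t -> 0 < F t -> is_derive t 1 F df ->
  is_derive t 1 (fun u => (F u / u) `^ s)
    (s * (F t / t) `^ (s - 1) * (df / t - F t / t ^+ 2)).
Proof.
move=> t0 Ft0 dF.
have A0 : 0 < F t / t by rewrite divr_gt0.
have dI : is_derive t 1 (fun u : R => u^-1) (- t ^- 2).
  have tN0 : t != 0 by rewrite gt_eqF.
  have := @is_deriveV R id t 1 1 tN0 (is_derive_id _ _).
  by move=> h; apply: is_derive_eq; rewrite /GRing.scale/= mulr1.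
have dA : is_derive t 1 (fun u => F u / u) (df / t - F t / t ^+ 2).
  have h := is_deriveM dF dI.
  by apply: is_derive_eq; rewrite /GRing.scale/= mulrN addrC mulrC.
have dP := is_derive1_powR s A0.
have h := @is_derive1_comp _ (fun x : R => x `^ s)
  (fun u : R => F u / u) t _ _ dP dA.
rewrite /comp in h.
by apply: is_derive_eq.
Qed.

Lemma continuous_mean_powR (R : realType) (F : R -> R) (df s t : R) :
  0 < t -> 0 < F t -> is_derive t 1 F df ->
  {for t, continuous (fun u => (F u / u) `^ s)}.
Proof.
move=> t0 Ft0 dF; have [h _] := is_derive_mean_powR s t0 Ft0 dF.
exact/differentiable_continuous/derivable1_diffP.
Qed.

Lemma integrable_segment (R : realType) (f : R -> R) (a b : R) :
  (forall t, t \in `[a, b] -> {for t, continuous f}) ->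
  lebesgue_measure.-integrable `[a, b] (EFin \o f).
Proof.
move=> cf; apply: continuous_compact_integrable; first exact: segment_compact.
by apply: continuous_in_subspaceT => t /[1!inE] /cf.
Qed.

Lemma measurable_segment (R : realType) (f : R -> R) (a b : R) :
  (forall t, t \in `[a, b] -> {for t, continuous f}) ->
  measurable_fun `[a, b] f.
Proof.
by move=> cf; apply/measurable_EFinP; apply: measurable_int (integrable_segment cf).
Qed.

(** The integrand is the derivative of t (F t / t)^p plus (p - 1) times
    (F t / t)^p. *)
Lemma integral_mean_powR (R : realType) (F dF : R -> R) (p a b : R) :
  1 < p -> 0 < a -> a < b ->
  (forall t, t \in `[a, b] -> 0 < F t) ->
  (forall t, t \in `[a, b] -> is_derive t 1 F (dF t)) ->
  (forall t, t \in `[a, b] -> {for t, continuous dF}) ->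
  (\int[lebesgue_measure]_(t in `[a, b])
     (p * (F t / t) `^ (p - 1) * dF t)%:E =
   (b * (F b / b) `^ p - a * (F a / a) `^ p)%:E +
   (p - 1)%:E * \int[lebesgue_measure]_(t in `[a, b]) ((F t / t) `^ p)%:E)%E.
Proof.
move=> p1 a0 ab F0 FdF cdF.
have pos t : t \in `[a, b] -> 0 < t.
  by rewrite in_itv/= => /andP[/(lt_le_trans a0)].
have cA s t : t \in `[a, b] -> {for t, continuous (fun u => (F u / u) `^ s)}.
  by move=> tab; exact: continuous_mean_powR (pos _ tab) (F0 _ tab) (FdF _ tab).
pose f1 t := p * (F t / t) `^ (p - 1) * dF t.
pose f2 t := (F t / t) `^ p.
pose dphi t := f1 t - (p - 1) * f2 t.
have cf1 t : t \in `[a, b] -> {for t, continuous f1}.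
  move=> tab; apply: cvgM; last exact: cdF.
  by apply: cvgM; [exact: cvg_cst|exact: cA].
have cf2 t : t \in `[a, b] -> {for t, continuous f2} by exact: cA.
have cf2' t : t \in `[a, b] -> {for t, continuous (fun t => (p - 1) * f2 t)}.
  by move=> tab; apply: cvgM; [exact: cvg_cst|exact: cf2].
have cdphi t : t \in `[a, b] -> {for t, continuous dphi}.
  by move=> tab; apply: cvgB; [exact: cf1|exact: cf2'].
have dphiE t : t \in `[a, b] -> is_derive t 1 (fun u => u * (F u / u) `^ p) (dphi t).
  move=> tab; have t0 := pos _ tab.
  have h := is_derive_mean_powR p t0 (F0 _ tab) (FdF _ tab).
  have h2 := is_deriveM (is_derive_id t 1) h.
  apply: is_derive_eq; rewrite /GRing.scale/= /dphi /f1 /f2 mulr1.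
  rewrite -[(F t / t) `^ p](@mulr_powRB1 _ _ p) ?divr_ge0 ?(ltW (F0 _ tab)) ?ltW//;
    last lra.
  set P := _ `^ _.
  by field; rewrite gt_eqF.
rewrite -(FTC2_is_derive ab dphiE cdphi).
rewrite -integralZl//; last exact: integrable_segment.
rewrite -integralD_EFin//; last 2 first.
- exact: integrable_segment.
- exact: integrable_segment.
by apply: eq_integral => t _; rewrite -EFinD /dphi subrK.
Qed.

(** * The inequality for a smooth primitive *)

(** [bernoulli_powR] at y = b d / A, multiplied by A^p; equality holds when
    b d = A. *)
Lemma young_tangent (R : realType) (p q b A d : R) :
  1 <= q -> 0 <= b -> 0 < A -> 0 <= d ->
  q * b * (A `^ (p - 1) * d) <=
  b `^ q * (A `^ (p - q) * d `^ q) + (q - 1) * A `^ p.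
Proof.
move=> q1 b0 A0 d0; have Ap0 s : 0 < A `^ s by exact: powR_gt0.
have y0 : 0 <= b * d / A by rewrite divr_ge0 ?mulr_ge0// ltW.
have := bernoulli_powR q1 y0.
rewrite -(ler_pM2l (Ap0 p)) powRM ?mulr_ge0 ?invr_ge0//; last exact: ltW.
rewrite powRM// -(powR_inv1 (ltW A0)) -powRrM mulN1r => h.
have AN0 : A != 0 by rewrite gt_eqF.
have E1 : A `^ (p - q) = A `^ p * A `^ (- q) by rewrite powRD// AN0 implybT.
have E2 : A `^ (p - 1) = A `^ p * A `^ (- 1) by rewrite powRD// AN0 implybT.
rewrite E1 E2; move: h; set P := A `^ p; set Q := A `^ (-q); set V := A `^ -1.
by set bq := b `^ q; set dq := d `^ q; lra.
Qed.

Lemma ge0_integralZl_real (R : realType) (D : set R) (c : R) (f : R -> R) :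
  measurable D -> 0 <= c -> (forall t, D t -> 0 <= f t) ->
  measurable_fun D f ->
  (c%:E * \int[lebesgue_measure]_(t in D) (f t)%:E =
   \int[lebesgue_measure]_(t in D) (c * f t)%:E)%E.
Proof.
move=> mD c0 f0 mf; rewrite -ge0_integralZl_EFin//; exact/measurable_EFinP.
Qed.

Lemma ge0_integralD_real (R : realType) (D : set R) (f g : R -> R) :
  measurable D -> (forall t, D t -> 0 <= f t) -> measurable_fun D f ->
  (forall t, D t -> 0 <= g t) -> measurable_fun D g ->
  (\int[lebesgue_measure]_(t in D) (f t)%:E +
   \int[lebesgue_measure]_(t in D) (g t)%:E =
   \int[lebesgue_measure]_(t in D) (f t + g t)%:E)%E.
Proof.
move=> mD f0 mf g0 mg; under [RHS]eq_integral do rewrite EFinD.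
by rewrite ge0_integralD//; exact/measurable_EFinP.
Qed.

Lemma ge0_le_integral_real (R : realType) (D : set R) (f g : R -> R) :
  measurable D -> (forall t, D t -> 0 <= f t) -> measurable_fun D f ->
  measurable_fun D g -> (forall t, D t -> f t <= g t) ->
  (\int[lebesgue_measure]_(t in D) (f t)%:E <=
   \int[lebesgue_measure]_(t in D) (g t)%:E)%E.
Proof.
move=> mD f0 mf mg fg.
by apply: ge0_le_integral => //; exact/measurable_EFinP.
Qed.

(** The inequality away from 0, for a smooth F.  The right-hand side is
    already written with majorants A of F / t and g of F', so that the same
    right-hand side serves every smooth approximation of g.  The coefficient
    of the first integral is q (beta + 1) (p - 1) - p (q - 1): the first term
    comes from [integral_mean_powR], the second from [young_tangent]. *)
Lemma hardy_segment (R : realType) (p q beta a : R) (F dF A g : R -> R) :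
  1 < p -> 1 <= q <= p -> 0 < beta -> 0 < a -> a < 1 ->
  (forall t, t \in `[a, 1] -> 0 < F t) ->
  (forall t, t \in `[a, 1] -> is_derive t 1 F (dF t)) ->
  (forall t, t \in `[a, 1] -> {for t, continuous dF}) ->
  (forall t, t \in `[a, 1] -> 0 <= dF t <= g t) ->
  (forall t, t \in `[a, 1] -> F t / t <= A t) ->
  measurable_fun `[a, 1] g -> measurable_fun `[a, 1] A ->
  (((p - 1) * q * beta + (p - q))%:E *
     \int[lebesgue_measure]_(t in `[a, 1%R]) ((F t / t) `^ p)%:E
   + (q * (beta + 1) * (F 1 `^ p - a * (F a / a) `^ p))%:E
   <= (p * (beta + 1) `^ q)%:E *
     \int[lebesgue_measure]_(t in `[a, 1%R]) (A t `^ (p - q) * g t `^ q)%:E)%E.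
Proof.
move=> p1 /andP[q1 qp] beta0 a0 a1 F0 FdF cdF dFg FA mg mA.
have pos t : t \in `[a, 1] -> 0 < t.
  by rewrite in_itv/= => /andP[/(lt_le_trans a0)].
have cM s t : t \in `[a, 1] -> {for t, continuous (fun u => (F u / u) `^ s)}.
  by move=> tab; exact: continuous_mean_powR (pos _ tab) (F0 _ tab) (FdF _ tab).
have := integral_mean_powR p1 a0 a1 F0 FdF cdF.
set S := (\int[_]_(_ in _) _)%E; set I := (\int[_]_(_ in _) _)%E.
set J := (\int[_]_(_ in _) _)%E => SE.
have Ifin : I \is a fin_num.
  by apply: (integrable_fin_num _ (integrable_segment (cM p))); exact: measurable_itv.
have J0 : (0 <= J)%E.
  by apply: integral_ge0 => t _; rewrite lee_fin mulr_ge0 ?powR_ge0.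
have mM s : measurable_fun `[a, 1] (fun t => (F t / t) `^ s).
  by apply: measurable_segment => t /cM.
have mJ : measurable_fun `[a, 1] (fun t => A t `^ (p - q) * g t `^ q).
  by apply: measurable_funM; exact: (measurableT_comp (measurable_powR _)).
have key : ((q * (beta + 1))%:E * S <=
    (p * (beta + 1) `^ q)%:E * J + (p * (q - 1))%:E * I)%E.
  have p0 : 0 <= p by lra.
  have c1 : 0 <= q * (beta + 1) by rewrite mulr_ge0//; lra.
  have c2 : 0 <= p * (beta + 1) `^ q by rewrite mulr_ge0 ?powR_ge0//; lra.
  have c3 : 0 <= p * (q - 1) by rewrite mulr_ge0//; lra.
  pose fS t := (F t / t) `^ (p - 1) * dF t.
  have fS0 t : t \in `[a, 1] -> 0 <= fS t.
    by move=> /dFg/andP[dF0 _]; rewrite mulr_ge0 ?powR_ge0.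
  have mS : measurable_fun `[a, 1] fS.
    by apply: measurable_funM => //; exact: measurable_segment.
  have -> : S = (\int[lebesgue_measure]_(t in `[a, 1%R]) (p * fS t)%:E)%E.
    by apply: eq_integral => t _; rewrite mulrA.
  rewrite /J /I !ge0_integralZl_real//; last 4 first.
  - by move=> t _; rewrite powR_ge0.
  - by move=> t _; rewrite mulr_ge0 ?powR_ge0.
  - by move=> t /fS0 fSt; exact: mulr_ge0.
  - exact: measurable_funM.
  rewrite ge0_integralD_real//; last 4 first.
  - by move=> t _; rewrite !mulr_ge0 ?powR_ge0//; lra.
  - exact: measurable_funM.
  - by move=> t _; rewrite mulr_ge0 ?powR_ge0.
  - exact: measurable_funM.
  apply: ge0_le_integral_real => //.
  - by move=> t /fS0 fSt; exact: mulr_ge0 c1 (mulr_ge0 p0 fSt).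
  - by apply: measurable_funM => //; exact: measurable_funM.
  - by apply: measurable_funD; exact: measurable_funM.
  move=> t tab; have /andP[dF0 dFgt] := dFg _ tab.
  have M0 : 0 < F t / t by rewrite divr_gt0 ?F0 ?pos.
  have b0 : 0 <= beta + 1 by lra.
  have := young_tangent p q1 b0 M0 dF0.
  have /(ler_wpM2l (powR_ge0 (beta + 1) q)) : 
     (F t / t) `^ (p - q) * dF t `^ q <= A t `^ (p - q) * g t `^ q.
    apply: ler_pM; rewrite ?powR_ge0//.
    - apply: ge0_ler_powR; rewrite ?nnegrE ?FA//; first lra; first exact: ltW.
      exact: le_trans (ltW M0) (FA _ tab).
    - apply: ge0_ler_powR; rewrite ?nnegrE//; first lra.
      exact: le_trans dFgt.
  move=> XY YW.
  have h : q * (beta + 1) * fS t <=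
      (beta + 1) `^ q * (A t `^ (p - q) * g t `^ q) + (q - 1) * (F t / t) `^ p.
    by apply: le_trans YW _; rewrite lerD2r.
  have := ler_wpM2l p0 h.
  lra.
move: key; rewrite SE -(fineK Ifin).
case: J J0 => [J| |]// J0; last first.
  move=> _; rewrite gt0_muley ?leey// lte_fin mulr_gt0 ?powR_gt0//; lra.
rewrite -!EFinM -!EFinD !lee_fin divr1 mul1r.
set x := F 1 `^ p; set y := (F a / a) `^ p; set z := _ `^ q.
by move: (fine I) => i; lra.
Qed.

(** * The primitive of an admissible function *)

(** Monotonicity is assumed on D only: an admissible function may be
    unbounded near 0, and then has no monotone extension to the line. *)
Lemma measurable_nonincreasing_on (R : realType) (D : interval R) (f : R -> R) :
  (forall s t, s \in D -> t \in D -> s <= t -> f t <= f s) ->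
  measurable_fun [set` D] f.
Proof.
move=> f_ni mD.
apply: (measurability _ (@RGenCInfty.measurableE R)) => // _ [_ [r] ->] <-.
apply: is_interval_measurable => s t [sD _] [tD ft] u /andP[su ut].
have {}ft : r <= f t by move: ft; rewrite /= in_itv/= andbT.
have uD : u \in D by apply: (@interval_is_interval _ D s t) => //; rewrite su.
by split => //=; rewrite in_itv/= andbT (le_trans ft)// f_ni.
Qed.

Section cumint.
Variables (R : realType) (f : R) (g : R -> R).
Hypothesis fg : admissible f g.
Notation mu := (@lebesgue_measure R).

Let g01 : R -> R := g \_ `]0, 1].

(** The primitive of g, extended by 0 to the left of 0 and by f to the right
    of 1.  The extension makes 0 an interior point of the domain on which G
    is continuous, so that G (t + h) and the derivative at 0 of a primitive
    of G make sense without one-sided limits. *)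
Definition cumint (t : R) : R := \int[mu]_(u in `[-1, t]) g01 u.
Local Notation G := cumint.

Lemma admissible_measurable : measurable_fun (`]0, 1] : set R) g.
Proof. by case: fg => _ gni _; exact: measurable_nonincreasing_on. Qed.

Lemma admissible_integrable : mu.-integrable (`]0, 1] : set R) (EFin \o g).
Proof.
have [g0 _ gf] := fg; apply/integrableP; split.
  by apply/measurable_EFinP; exact: admissible_measurable.
suff -> : (\int[mu]_(x in `]0%R, 1%R]) `|(EFin \o g) x| = f%:E)%E by rewrite ltry.
rewrite -gf; apply: eq_integral => t /[1!inE] /g0 gt0.
by rewrite /= ger0_norm.
Qed.

Lemma integrable_g01 (D : set R) : measurable D -> mu.-integrable D (EFin \o g01).
Proof.
move=> mD; rewrite /g01 -restrict_EFin; apply/integrable_restrict => //.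
apply: integrableS admissible_integrable => //; exact: measurableI.
Qed.

Lemma g01_ge0 t : 0 <= g01 t.
Proof.
have [g0 _ _] := fg; rewrite /g01 patchE; case: ifPn => // /[1!inE].
exact: g0.
Qed.

Lemma cumintB s t : -1 <= s -> s <= t ->
  G t - G s = \int[mu]_(u in `]s, t]) g01 u.
Proof.
by move=> s1 st; rewrite /G Rintegral_itvB ?bnd_simp//; exact: integrable_g01.
Qed.

Lemma cumint_le s t : -1 <= s -> s <= t -> G s <= G t.
Proof.
move=> s1 st; rewrite -subr_ge0 cumintB//.
by apply: Rintegral_ge0 => u _; exact: g01_ge0.
Qed.

Lemma cumint0 : G 0 = 0.
Proof.
rewrite /G /Rintegral integral0_eq// => u /=; rewrite in_itv/= => /andP[_ u0].
by rewrite /g01 patchE memNset//= in_itv/= ltNge u0.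
Qed.

Lemma EFin_cumint t : 0 <= t -> 
  (G t)%:E = (\int[mu]_(u in `]0%R, t] `&` `]0%R, 1%R]) (g u)%:E)%E.
Proof.
move=> t0; rewrite integral_mkcondr.
have -> : G t = \int[mu]_(u in `]0, t]) g01 u.
  by rewrite -cumintB ?lerN10// cumint0 subr0.
rewrite /Rintegral fineK; last first.
  by apply: integrable_fin_num => //; exact: integrable_g01.
by apply: eq_integral => u _; rewrite restrict_EFin.
Qed.

Lemma average_cumint t : t \in `]0, 1] -> average g t = G t / t.
Proof.
rewrite in_itv/= => /andP[t0 t1].
have tE : `]0, t] `&` `]0, 1] = `]0, t]%classic :> set R.
  by apply/setIidPl/subset_itvl; rewrite bnd_simp.
by rewrite /average mulrC /Rintegral -tE -EFin_cumint// ltW.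
Qed.

Lemma cumint_ge1 t : 1 <= t -> G t = f.
Proof.
move=> t1; apply: EFin_inj; rewrite EFin_cumint; last exact: le_trans t1.
have [_ _ <-] := fg; rewrite (_ : `]0, t] `&` `]0, 1] = `]0, 1]%classic)//.
by apply/setIidPr/subset_itvl; rewrite bnd_simp.
Qed.

(** This is where monotonicity of g enters: to the right of t the integrand
    is at most g t. *)
Lemma cumintB_le t h : t \in `]0, 1] -> 0 <= h ->
  G (t + h) - G t <= h * g t.
Proof.
move=> t01 h0; have [g0 gni _] := fg.
have /andP[t0 t1] : (0 < t) && (t <= 1) by move: t01; rewrite in_itv.
rewrite cumintB ?lerDl//; last lra.
have : \int[mu]_(u in `]t, (t + h)]) g01 u <= \int[mu]_(u in `]t, (t + h)]) g t.
  apply: le_Rintegral => //; first exact: integrable_g01.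
    have ic : mu.-integrable `[t, t + h] (EFin \o fun=> g t).
      by apply: integrable_segment => u _; exact: cvg_cst.
    by apply: integrableS ic => //; apply: subset_itvr; rewrite bnd_simp.
  move=> u /=; rewrite in_itv/= => /andP[tu _]; rewrite /g01 patchE.
  case: ifPn => [/[1!inE] u01|_]; last exact: g0.
  by apply: gni => //; exact: ltW.
move=> /le_trans; apply; rewrite Rintegral_cst//.
rewrite /= lebesgue_measure_itv/= lte_fin; case: ifPn => _ /=; last first.
  by rewrite mulr0 mulr_ge0// g0.
by rewrite addrAC subrr add0r mulrC.
Qed.

Lemma continuous_cumint (t : R) : t \in `]-1, 3[ -> {for t, continuous G}.
Proof.
move=> t13.
have : {within `[-1, 3], continuous G}.
  apply: (@parameterized_integral_continuous _ (-1) 3 g01) => //; first lra.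
  exact: integrable_g01.
have h : -1 < 3 :> R by lra.
by case/(continuous_within_itvP _ h) => + _ _; apply.
Qed.

Lemma measurable_average : measurable_fun (`]0, 1] : set R) (average g).
Proof.
apply: (eq_measurable_fun (fun t => G t * t^-1)).
  by move=> t /[1!inE] /average_cumint.
apply: measurable_funM.
  rewrite -[X in measurable_fun _ X]opprK; apply: measurableT_comp => //.
  apply: measurable_nonincreasing_on => s t; rewrite !in_itv/= => s01 t01 st.
  by rewrite lerN2 cumint_le//; lra.
apply: measurable_nonincreasing_on => s t; rewrite !in_itv/= => s01 t01 st.
by rewrite lef_pV2 ?posrE//; lra.
Qed.

End cumint.

(** If G t = 0 then t g t <= G t forces g t = 0, so nothing is gained after
    t either and f = G 1 = 0. *)
Lemma cumint_gt0 (R : realType) (f : R) (g : R -> R) t :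
  admissible f g -> 0 < f -> t \in `]0, 1] -> 0 < cumint g t.
Proof.
move=> fg f0 t01; have [g0 gni _] := fg.
have /andP[t0 t1] : (0 < t) && (t <= 1) by move: t01; rewrite in_itv.
rewrite lt_neqAle eq_sym; apply/andP; split; last first.
  by rewrite -(cumint0 g) (cumint_le fg)//; lra.
apply/eqP => Gt0.
have gt0 : g t = 0.
  apply/eqP; rewrite eq_le g0// andbT.
  have : t * g t <= cumint g t.
    have ic : lebesgue_measure.-integrable `]0, t] (EFin \o fun=> g t).
      have : lebesgue_measure.-integrable `[0, t] (EFin \o fun=> g t).
        by apply: integrable_segment => u _; exact: cvg_cst.
      by apply: integrableS => //; apply: subset_itvr; rewrite bnd_simp.
    rewrite -[leRHS]subr0 -(cumint0 g) (cumintB fg) ?lerN10//; last exact: ltW.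
    have : \int[lebesgue_measure]_(u in `]0, t]) g t <=
           \int[lebesgue_measure]_(u in `]0, t]) (g \_ `]0, 1]) u.
      apply: le_Rintegral => //; first exact: (integrable_g01 fg).
      move=> u /=; rewrite in_itv/= => /andP[u0 ut].
      have u01 : u \in `]0, 1] by rewrite in_itv/= u0 (le_trans ut).
      by rewrite patchE mem_set// gni.
    rewrite Rintegral_cst//= lebesgue_measure_itv/= lte_fin t0 /=.
    by rewrite oppr0 addr0 mulrC.
  by rewrite Gt0 pmulr_rle0.
have t1' : 0 <= 1 - t by lra.
have := cumintB_le fg t01 t1'.
rewrite gt0 mulr0 Gt0 subr0 addrC subrK (cumint_ge1 fg)//; lra.
Qed.

(** * Smoothing by difference quotients *)

Section smoothing.
Variables (R : realType) (f h : R) (g : R -> R).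
Notation mu := (@lebesgue_measure R).
Notation G := (cumint g).

Let H (t : R) : R := \int[mu]_(u in `[-1, t]) G u.

(** The primitive vanishing at 0 of the difference quotient [dsmooth]. *)
Definition smooth (t : R) : R := h^-1 * (H (t + h) - H t - (H h - H 0)).
Definition dsmooth (t : R) : R := h^-1 * (G (t + h) - G t).

Let is_derive_H (fg : admissible f g) (t : R) : -1 < t -> t < 3 -> is_derive t 1 H (G t).
Proof.
move=> t1 t3.
have iG : mu.-integrable `[-1, 3] (EFin \o G).
  apply: continuous_compact_integrable; first exact: segment_compact.
  apply: (@parameterized_integral_continuous _ (-1) 3 (g \_ `]0, 1])) => //; first lra.
  exact: (integrable_g01 fg).
have cG : {for t, continuous G}.
  by apply: (continuous_cumint fg); rewrite in_itv/= t1.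
have [] := continuous_FTC1_closed t3 iG t1 cG.
by move=> dH HG; apply: DeriveDef; [exact: dH|rewrite -derive1E; exact: HG].
Qed.

Lemma is_derive_smooth (fg : admissible f g) (h0 : 0 < h) (h1 : h <= 1) (t : R) :
  0 <= t <= 1 -> is_derive t 1 smooth (dsmooth t).
Proof.
move=> /andP[t0 t1].
have d1 : is_derive (t + h) 1 H (G (t + h)) by apply: (is_derive_H fg); lra.
have d2 : is_derive t 1 H (G t) by apply: (is_derive_H fg); lra.
have d3 : is_derive t 1 (fun u => u + h) 1.
  by apply: is_derive_eq; rewrite addr0.
have d4 : is_derive t 1 (fun u => H (u + h)) (G (t + h)).
  have := @is_derive1_comp _ H (fun u : R => u + h) t _ _ d1 d3.
  by rewrite mulr1.
by rewrite /smooth /dsmooth; apply: is_derive_eq; rewrite /GRing.scale/= subr0.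
Qed.

Lemma continuous_dsmooth (fg : admissible f g) (h0 : 0 < h) (h1 : h <= 1) (t : R) :
  0 <= t <= 1 -> {for t, continuous dsmooth}.
Proof.
move=> /andP[t0 t1].
have c1 : {for t + h, continuous G}.
  by apply: (continuous_cumint fg); rewrite in_itv/=; lra.
have c2 : {for t, continuous G}.
  by apply: (continuous_cumint fg); rewrite in_itv/=; lra.
apply: cvgM; first exact: cvg_cst.
apply: cvgB => //.
have c3 : {for t, continuous (fun u => u + h)}.
  by apply: cvgD; [exact: cvg_id|exact: cvg_cst].
exact: (@continuous_comp _ _ _ (fun u => u + h) G).
Qed.

Lemma dsmooth_ge0 (fg : admissible f g) (h0 : 0 < h) (t : R) :
  0 <= t <= 1 -> 0 <= dsmooth t.
Proof.
move=> /andP[t0 t1]; rewrite /dsmooth mulr_ge0 ?invr_ge0 ?(ltW h0)// subr_ge0.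
by apply: (cumint_le fg); lra.
Qed.

Lemma dsmooth_le (fg : admissible f g) (h0 : 0 < h) (t : R) :
  t \in `]0, 1] -> dsmooth t <= g t.
Proof.
move=> t01; rewrite /dsmooth ler_pdivrMl//.
exact: (cumintB_le fg t01 (ltW h0)).
Qed.

Lemma dsmooth_bound (fg : admissible f g) (h0 : 0 < h) (h1 : h <= 1) (t : R) :
  0 <= t <= 1 -> dsmooth t <= h^-1 * f.
Proof.
move=> /andP[t0 t1]; rewrite ler_pM2l ?invr_gt0//.
have f1 : G 2 = f by apply: (cumint_ge1 fg); lra.
have : G (t + h) <= G 2 by apply: (cumint_le fg); lra.
have : 0 <= G t by rewrite -(cumint0 g); apply: (cumint_le fg); lra.
lra.
Qed.

Lemma smooth0 : smooth 0 = 0.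
Proof. by rewrite /smooth add0r subrr mulr0. Qed.

Let smooth_MVT (fg : admissible f g) (h0 : 0 < h) (h1 : h <= 1) (s t : R) :
  0 <= s -> s < t -> t <= 1 ->
  exists2 c, s < c < t & smooth t - smooth s = dsmooth c * (t - s).
Proof.
move=> s0 st t1.
have [||c cst E] := @MVT R smooth dsmooth s t st.
- move=> u; rewrite in_itv/= => /andP[su ut]; apply: (is_derive_smooth fg h0 h1); lra.
- apply: derivable_within_continuous => u; rewrite in_itv/= => /andP[su ut].
  have [] : is_derive u 1 smooth (dsmooth u).
    by apply: (is_derive_smooth fg h0 h1); lra.
  by [].
- by exists c; rewrite // in_itv/= in cst.
Qed.

(** The bound depends on h but not on t, which makes the boundary term
    a (F a / a)^p of [hardy_segment] tend to 0 with a. *)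
Lemma smooth_bound (fg : admissible f g) (h0 : 0 < h) (h1 : h <= 1) (t : R) :
  t \in `]0, 1] -> smooth t / t <= h^-1 * f.
Proof.
rewrite in_itv/= => /andP[t0 t1]; rewrite ler_pdivrMr//.
have [c /andP[c0 ct]] := smooth_MVT fg h0 h1 (lexx 0) t0 t1.
rewrite smooth0 !subr0 => ->; rewrite ler_pM2r//; apply: (dsmooth_bound fg h0); lra.
Qed.

(** The derivative at 0 is G h / h > 0, so by continuity the function
    increases strictly near 0, and it never decreases afterwards. *)
Lemma smooth_gt0 (fg : admissible f g) (f0 : 0 < f) (h0 : 0 < h) (h1 : h <= 1) (t : R) :
  t \in `]0, 1] -> 0 < smooth t.
Proof.
rewrite in_itv/= => /andP[t0 t1].
have d0 : 0 < dsmooth 0.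
  rewrite /dsmooth add0r cumint0 subr0 mulr_gt0 ?invr_gt0//.
  by apply: (cumint_gt0 fg) => //; rewrite in_itv/= h0.
have c0 : {for 0, continuous dsmooth}.
  by apply: (continuous_dsmooth fg h0 h1); rewrite lexx ler01.
(* a right neighbourhood of 0 on which the derivative stays positive *)
have [s /andP[s0 st] ds] : exists2 s, 0 < s < t & forall u, 0 < u < s -> 0 < dsmooth u.
  have /cvgrPdist_lt/(_ _ d0) := c0.
  rewrite near_simpl/= => -[e /= e0 He].
  exists (Num.min e t / 2).
    by rewrite divr_gt0 ?lt_min ?e0 ?t0//= ltr_pdivrMr// gt_min; apply/orP; right; lra.
  move=> u /andP[u0 ue].
  have ue' : u < e.
    apply: (lt_le_trans ue); rewrite ler_pdivrMr// ge_min; apply/orP; left; lra.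
  have := He u; rewrite /ball_/= sub0r normrN gtr0_norm// => /(_ ue').
  by rewrite ltr_norml; lra.
have s1 : s <= 1 by lra.
have [c cs] := smooth_MVT fg h0 h1 (lexx 0) s0 s1.
rewrite smooth0 !subr0 => Es.
have [d dst E] := smooth_MVT fg h0 h1 (ltW s0) st t1.
have dd : 0 <= dsmooth d by apply: (dsmooth_ge0 fg h0); lra.
have : 0 < smooth s by rewrite Es mulr_gt0// ds.
have : 0 <= smooth t - smooth s by rewrite E mulr_ge0//; lra.
lra.
Qed.

Lemma smooth_le (fg : admissible f g) (h0 : 0 < h) (h1 : h <= 1) (t : R) :
  t \in `]0, 1] -> smooth t <= G t.
Proof.
move=> t01; have /andP[t0 t1] : (0 < t) && (t <= 1) by move: t01; rewrite in_itv.
rewrite -lee_fin (EFin_cumint fg); last exact: ltW.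
have -> : `]0, t] `&` `]0, 1] = `]0, t]%classic :> set R.
  by apply/setIidPl/subset_itvl; rewrite bnd_simp.
have cd u : u \in `[0, t] -> {for u, continuous dsmooth}.
  by rewrite in_itv/= => ut; apply: (continuous_dsmooth fg h0 h1); lra.
have md : measurable_fun `[0, t] dsmooth by exact: measurable_segment.
have {}md : measurable_fun `]0, t] dsmooth.
  by apply: measurable_funS md => //; apply: subset_itvr; rewrite bnd_simp.
have dS u : u \in `[0, t] -> is_derive u 1 smooth (dsmooth u).
  by rewrite in_itv/= => ut; apply: (is_derive_smooth fg h0 h1); lra.
have := FTC2_is_derive t0 dS cd; rewrite smooth0 subr0 => <-.
rewrite -integral_itv_obnd_cbnd; last exact/measurable_EFinP.
apply: ge0_le_integral_real => //.
- move=> u /=; rewrite in_itv/= => ut; apply: (dsmooth_ge0 fg h0); lra.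
- apply: measurable_funS (admissible_measurable fg) => //.
  by apply: subset_itvl; rewrite bnd_simp.
- move=> u /=; rewrite in_itv/= => ut; apply: (dsmooth_le fg h0); rewrite in_itv/=; lra.
Qed.

(** By the mean value theorem the two increments of H are h (G c) and
    h (G d) with t < c and d < h. *)
Lemma smooth_ge (fg : admissible f g) (h0 : 0 < h) (h1 : h <= 1) (t : R) :
  t \in `]0, 1] -> G t - G h <= smooth t.
Proof.
rewrite in_itv/= => /andP[t0 t1].
have HE s : 0 <= s <= 1 -> exists2 c, s < c < s + h & H (s + h) - H s = G c * h.
  move=> /andP[s0 s1]; have st : s < s + h by rewrite ltrDl.
  have [||c cst E] := @MVT R H G s (s + h) st.
  - move=> u; rewrite in_itv/= => /andP[su ut]; apply: (is_derive_H fg); lra.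
  - apply: derivable_within_continuous => u; rewrite in_itv/= => /andP[su ut].
    by have [] : is_derive u 1 H (G u) by apply: (is_derive_H fg); lra.
  - by exists c; [rewrite in_itv/= in cst|rewrite E addrAC subrr add0r].
have [|c ct E1] := HE t; first by rewrite ltW.
have [|d dt] := HE 0; first by rewrite lexx ler01.
rewrite add0r => E2.
rewrite /smooth E1 E2 -mulrBl mulrCA mulVf ?gt_eqF// mulr1 lerB//.
  by apply: (cumint_le fg); lra.
by apply: (cumint_le fg); lra.
Qed.
End smoothing.

(** * Passage to the limit *)

Lemma fatou_le_cvg (R : realType) (D : set R) (u : nat -> R -> R) (v : R -> R)
    (r : nat -> R) (l : R) :
  measurable D -> (forall n, measurable_fun D (u n)) ->
  (forall n t, D t -> 0 <= u n t) ->
  (forall t, D t -> u n t @[n --> \oo] --> v t) ->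
  (forall n, (\int[lebesgue_measure]_(t in D) (u n t)%:E <= (r n)%:E)%E) ->
  r @ \oo --> l ->
  (\int[lebesgue_measure]_(t in D) (v t)%:E <= l%:E)%E.
Proof.
move=> mD mu u0 uv ur rl.
have mEu n : measurable_fun D (fun t => (u n t)%:E) by exact/measurable_EFinP.
have -> : (\int[lebesgue_measure]_(t in D) (v t)%:E =
           \int[lebesgue_measure]_(t in D) limn_einf (fun n => (u n t)%:E))%E.
  apply: eq_integral => t /[1!inE] Dt.
  have h : (u n t)%:E @[n --> \oo] --> (v t)%:E.
    by apply: cvg_EFin; [exact: nearW|exact: uv].
  by rewrite is_cvg_limn_einfE ?(cvg_lim _ h)//; apply/cvg_ex; exists (v t)%:E.
apply: le_trans (fatou lebesgue_measure mD mEu _) _.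
  by move=> n t Dt; rewrite lee_fin u0.
have rl' : (r n)%:E @[n --> \oo] --> l%:E by apply: cvg_EFin; [exact: nearW|].
rewrite limn_einf_lim -(cvg_lim _ rl')//; apply: lee_lim.
- exact: is_cvg_einfs.
- by apply/cvg_ex; exists l%:E.
- apply: nearW => n; apply: le_trans (ur n).
  by apply: ereal_inf_lbound; exists n => /=.
Qed.

Lemma continuous_powR (R : realType) (s x : R) :
  0 < x -> {for x, continuous (fun y : R => y `^ s)}.
Proof.
by move=> x0; have [h _] := is_derive1_powR s x0;
  exact/differentiable_continuous/derivable1_diffP.
Qed.

(** For h = 1 / (n + 1), [hardy_segment] is applied to [smooth h g] on
    [eps n, 1].  The left end eps n is chosen so small compared with the
    bound M n of the difference quotient that the boundary term is at most
    1 / (n + 2); then n tends to infinity. *)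
Lemma hardy_inequality_gt0 (R : realType) (p q f beta : R) (g : R -> R) :
  1 < p -> 1 <= q <= p -> admissible f g -> 0 < f -> 0 < beta ->
  (((p - 1) * q * beta + (p - q))%:E *
     \int[lebesgue_measure]_(t in `]0%R, 1%R]) (average g t `^ p)%:E
   + (q * (beta + 1) * f `^ p)%:E
   <= (p * (beta + 1) `^ q)%:E *
     \int[lebesgue_measure]_(t in `]0%R, 1%R])
       (average g t `^ (p - q) * g t `^ q)%:E)%E.
Proof.
move=> p1 q1p fg f0 beta0; have [q1 qp] := andP q1p.
set D := (p - 1) * q * beta + (p - q); set B := q * (beta + 1).
have D0 : 0 < D by rewrite /D ltr_pwDl ?mulr_gt0//; lra.
set I := (\int[_]_(_ in _) _)%E; set J := (\int[_]_(_ in _) _)%E.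
have p0 : 0 < p by lra.
have J0 : (0 <= J)%E.
  by apply: integral_ge0 => t _; rewrite lee_fin mulr_ge0 ?powR_ge0.
have K0 : 0 < p * (beta + 1) `^ q by rewrite mulr_gt0 ?powR_gt0//; lra.
have mA := measurable_average fg.
have mg := admissible_measurable fg.
have mJ : measurable_fun (`]0, 1] : set R) (fun t => average g t `^ (p - q) * g t `^ q).
  by apply: measurable_funM; exact: (measurableT_comp (measurable_powR _)).
(* if J is infinite there is nothing to prove *)
case EJ : J J0 => [j| |]// J0; last by rewrite gt0_muley ?leey.
pose h n : R := n.+1%:R^-1.
have h0 n : 0 < h n by rewrite invr_gt0 ltr0n.
have h1 n : h n <= 1 by rewrite invf_le1 ?ltr0n// ler1n.
pose M n := (h n)^-1 * f.
have M0 n : 0 < M n by rewrite mulr_gt0 ?invr_gt0.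
(* the factor n + 2 makes eps n tend to 0; the other one beats M n ^ p *)
pose eps n : R := (n.+2%:R * (1 + M n `^ p))^-1.
have den n : 1 < n.+2%:R * (1 + M n `^ p).
  have : 1 < n.+2%:R :> R by rewrite ltr1n.
  by have := powR_gt0 p (M0 n); nra.
have eps0 n : 0 < eps n by rewrite invr_gt0; have := den n; lra.
have eps1 n : eps n < 1 by rewrite invf_lt1 ?den//; have := den n; lra.
have epsM n : eps n * M n `^ p <= n.+2%:R^-1.
  have n2 : 0 < n.+2%:R :> R by rewrite ltr0n.
  have Mp := powR_gt0 p (M0 n).
  rewrite /eps invfM -mulrA ler_piMr ?invr_ge0 ?ltW//.
  by rewrite ltr_pdivrMl ?mulr1; lra.
have epsn n : eps n <= n.+2%:R^-1.
  have n2 : 0 < n.+2%:R :> R by rewrite ltr0n.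
  have Mp := powR_gt0 p (M0 n).
  by rewrite /eps invfM ler_piMr ?invr_ge0 ?ltW// invf_lt1; lra.
pose F n := smooth (h n) g.
have F0 n t : t \in `]0, 1] -> 0 < F n t by apply: (smooth_gt0 fg f0 (h0 n) (h1 n)).
have sub n : {subset `[eps n, 1] <= `]0, 1]}.
  by move=> t; rewrite !in_itv/= => /andP[/(lt_le_trans (eps0 n)) -> ->].
have one01 : 1 \in `]0, 1 : R] by rewrite in_itv/= ltr01 lexx.
pose u n : R -> R := (fun t => (F n t / t) `^ p) \_ `[eps n, 1].
have step n : (\int[lebesgue_measure]_(t in `]0%R, 1%R]) (u n t)%:E <=
    ((p * (beta + 1) `^ q * j - B * (F n 1 `^ p - n.+2%:R^-1)) / D)%:E)%E.
  have := @hardy_segment R p q beta (eps n) (F n) (dsmooth (h n) g)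
    (average g) g p1 q1p beta0 (eps0 n) (eps1 n).
  have dS t : t \in `[eps n, 1] -> is_derive t 1 (F n) (dsmooth (h n) g t).
    move=> /sub; rewrite in_itv/= => t01.
    by apply: (is_derive_smooth fg (h0 n) (h1 n)); lra.
  have cS t : t \in `[eps n, 1] -> {for t, continuous (dsmooth (h n) g)}.
    move=> /sub; rewrite in_itv/= => t01.
    by apply: (continuous_dsmooth fg (h0 n) (h1 n)); lra.
  have leS t : t \in `[eps n, 1] -> 0 <= dsmooth (h n) g t <= g t.
    move=> /sub t01; rewrite (dsmooth_le fg (h0 n))// andbT.
    by move: t01; rewrite in_itv/= => t01; apply: (dsmooth_ge0 fg (h0 n)); lra.
  have leA t : t \in `[eps n, 1] -> F n t / t <= average g t.
    move=> /sub t01; rewrite (average_cumint fg)// ler_wpM2r//; last first.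
      exact: (smooth_le fg (h0 n) (h1 n)).
    by move: t01; rewrite in_itv/= invr_ge0 => /andP[/ltW].
  have subs : `[eps n, 1] `<=` `]0, 1] by move=> t /sub.
  move=> /(_ (fun t tab => F0 n t (sub n t tab)) dS cS leS leA).
  have mg' : measurable_fun `[eps n, 1] g by exact: measurable_funS mg.
  have mA' : measurable_fun `[eps n, 1] (average g) by exact: measurable_funS mA.
  move=> /(_ mg' mA').
  have -> : (\int[lebesgue_measure]_(t in `[eps n, 1%R]) ((F n t / t) `^ p)%:E =
             \int[lebesgue_measure]_(t in `]0%R, 1%R]) (u n t)%:E)%E.
    rewrite -[X in (integral _ X _ = _)%E](setIidr subs) integral_mkcondr.
    by apply: eq_integral => t _; rewrite restrict_EFin.
  have : (\int[lebesgue_measure]_(t in `[eps n, 1%R])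
      (average g t `^ (p - q) * g t `^ q)%:E <= j%:E)%E.
    rewrite -EJ; apply: ge0_subset_integral => //; first exact/measurable_EFinP.
    by move=> t _; rewrite lee_fin mulr_ge0 ?powR_ge0.
  set J' := (\int[_]_(_ in _) _)%E => J'j; set U := (\int[_]_(_ in _) _)%E => key.
  have U0 : (0 <= U)%E.
    apply: integral_ge0 => t _; rewrite lee_fin /u patchE.
    by case: ifP => // _; exact: powR_ge0.
  have {}key : (D%:E * U + (B * (F n 1 `^ p - eps n * (F n (eps n) / eps n) `^ p))%:E <=
      (p * (beta + 1) `^ q * j)%:E)%E.
    by apply: le_trans key _; rewrite [leRHS]EFinM lee_pmul2l// lte_fin.
  have eps01 : eps n \in `]0, 1] by rewrite in_itv/= eps0 ltW.
  have bd : eps n * (F n (eps n) / eps n) `^ p <= n.+2%:R^-1.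
    apply: le_trans (epsM n); rewrite ler_pM2l//.
    have Fe : F n (eps n) / eps n <= M n by exact: (smooth_bound fg (h0 n) (h1 n)).
    apply: ge0_ler_powR Fe; rewrite ?nnegrE ?divr_ge0//; last exact: ltW.
    - exact: ltW.
    - by apply: ltW; exact: F0.
    - exact: ltW.
  have B0 : 0 < B by rewrite mulr_gt0; lra.
  move: bd key; set e := eps n * _ => bd.
  case: U U0 => [U| |]// U0; last by rewrite gt0_muley//= lte_fin.
  rewrite -EFinM -EFinD !lee_fin ler_pdivlMr// => key.
  have alg (U' D' B' P' e' N' K' : R) : D' * U' + B' * (P' - e') <= K' ->
      B' * e' <= B' * N' -> U' * D' <= K' - B' * (P' - N') by lra.
  exact: alg key (ler_wpM2l (ltW B0) bd).
(* G t - G (h n) <= F n t <= G t, and G (h n) tends to G 0 = 0 *)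
have cG t : t \in `]0, 1] -> F n t @[n --> \oo] --> cumint g t.
  move=> t01.
  apply: (@squeeze_cvgr _ _ _ _ (fun n => cumint g t - cumint g (h n))
    (fun=> cumint g t)).
  - apply: nearW => n; apply/andP; split; first exact: (smooth_ge fg (h0 n) (h1 n)).
    exact: (smooth_le fg (h0 n) (h1 n)).
  - rewrite -[X in _ --> X]subr0 -(cumint0 g).
    apply: cvgB; first exact: cvg_cst.
    have c0 : {for 0, continuous (cumint g)}.
      by apply: (continuous_cumint fg); rewrite in_itv/=; lra.
    exact: (cvg_comp _ _ (@cvg_harmonic R) c0).
  - exact: cvg_cst.
have G0 t : t \in `]0, 1] -> 0 < cumint g t by apply: (cumint_gt0 fg).
have cu t : t \in `]0, 1] -> u n t @[n --> \oo] --> average g t `^ p.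
  move=> t01; have /andP[t0 t1] : (0 < t) && (t <= 1) by move: t01; rewrite in_itv.
  have : (F n t / t) `^ p @[n --> \oo] --> average g t `^ p.
    rewrite (average_cumint fg)//.
    apply: (cvg_comp (fun n => F n t / t) (fun y => y `^ p)).
      by apply: cvgM; [exact: cG|exact: cvg_cst].
    by apply: continuous_powR; rewrite divr_gt0 ?G0.
  apply: cvg_trans; apply: near_eq_cvg.
  have : \forall n \near \oo, harmonic n < t by exact: (cvgr_lt _ (@cvg_harmonic R)).
  apply: filterS => n nt; rewrite /u patchE mem_set//= in_itv/= t1 andbT.
  apply: le_trans (epsn n) _; apply: le_trans (ltW nt).
  by rewrite lef_pV2 ?posrE ?ltr0n// ler_nat.
have cr : (p * (beta + 1) `^ q * j - B * (F n 1 `^ p - n.+2%:R^-1)) / D @[n --> \oo]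
   --> (p * (beta + 1) `^ q * j - B * (f `^ p - 0)) / D.
  apply: cvgM; last exact: cvg_cst.
  apply: cvgB; first exact: cvg_cst.
  apply: cvgM; first exact: cvg_cst.
  apply: cvgB.
    have f1 : cumint g 1 = f by apply: (cumint_ge1 fg).
    rewrite -f1.
    apply: (cvg_comp (fun n => F n 1) (fun y => y `^ p)); first exact: cG.
    by apply: continuous_powR; rewrite f1.
  have := @cvg_harmonic R; rewrite -cvg_shiftS.
  exact.
have : (I <= ((p * (beta + 1) `^ q * j - B * (f `^ p - 0)) / D)%:E)%E.
  apply: (@fatou_le_cvg _ _ u _ _ _ _ _ _ _ _ cr) => //.
  - move=> n; apply/measurable_restrict => //.
    rewrite setIidr; last by move=> t /sub.
    apply: measurable_segment => t /sub t01.
    apply: continuous_mean_powR; last apply: (is_derive_smooth fg (h0 n) (h1 n)).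
    + by move: t01; rewrite in_itv/= => /andP[].
    + exact: F0.
    + by move: t01; rewrite in_itv/= => /andP[/ltW-> ->].
  - by move=> n t _; rewrite /u patchE; case: ifP => // _; exact: powR_ge0.
have I0 : (0 <= I)%E by apply: integral_ge0 => t _; rewrite lee_fin powR_ge0.
case: I I0 => [i| |]// I0.
rewrite lee_fin subr0 ler_pdivlMr// -EFinM -EFinD -EFinM lee_fin; lra.
Qed.

Lemma admissible_ge0 (R : realType) (f : R) (g : R -> R) :
  admissible f g -> 0 <= f.
Proof.
move=> [g0 _ gf]; rewrite -lee_fin -gf.
by apply: integral_ge0 => t t01; rewrite lee_fin g0.
Qed.

Lemma average_admissible0 (R : realType) (g : R -> R) t :
  admissible 0 g -> t \in `]0, 1] -> average g t = 0.
Proof.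
move=> g0 t01; have /andP[t0 t1] : (0 < t) && (t <= 1) by move: t01; rewrite in_itv.
have G0 : 0 <= cumint g t by rewrite -(cumint0 g); apply: (cumint_le g0); lra.
have : cumint g t <= cumint g 1 by apply: (cumint_le g0); lra.
rewrite (cumint_ge1 g0 (lexx 1)) => Gt0.
by rewrite (average_cumint g0)//; apply/eqP; rewrite mulf_eq0 eq_le Gt0 G0.
Qed.

(** Division of [hardy_inequality_gt0] by D.  The case f = 0, where
    all averages vanish, is separate: the case f > 0 differentiates powers of
    positive averages. *)
Lemma hardy_inequality (R : realType) (p q f beta : R) (g : R -> R) :
  1 < p -> 1 <= q <= p -> admissible f g -> 0 < beta ->
  (\int[lebesgue_measure]_(t in `]0%R, 1%R]) (average g t `^ p)%:E
     <= (- (q * (beta + 1) / ((p - 1) * q * beta + (p - q)) * f `^ p))%:E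
        + (p * (beta + 1) `^ q / ((p - 1) * q * beta + (p - q)))%:E
          * \int[lebesgue_measure]_(t in `]0%R, 1%R])
              (average g t `^ (p - q) * g t `^ q)%:E)%E.
Proof.
move=> p1 q1p fg beta0; have [q1 qp] := andP q1p.
have D0 : 0 < (p - 1) * q * beta + (p - q) by rewrite ltr_pwDl ?mulr_gt0//; lra.
have := admissible_ge0 fg; rewrite le_eqVlt => /predU1P[f0|f0].
  have J0 : (0 <= \int[lebesgue_measure]_(t in `]0%R, 1%R])
              (average g t `^ (p - q) * g t `^ q)%:E)%E.
    by apply: integral_ge0 => t _; rewrite lee_fin mulr_ge0 ?powR_ge0.
  rewrite -f0 powR0; last by rewrite gt_eqF; lra.
  rewrite mulr0 oppr0 add0e integral0_eq.
    by rewrite mule_ge0// lee_fin divr_ge0 ?mulr_ge0 ?powR_ge0//; lra.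
  have g0 : admissible 0 g by rewrite f0.
  by move=> t t01; rewrite (average_admissible0 g0)// powR0// gt_eqF//; lra.
have := hardy_inequality_gt0 p1 q1p fg f0 beta0; move: D0.
set D := _ + (p - q); set I := (\int[_]_(_ in _) _)%E.
set J := (\int[_]_(_ in _) _)%E => D0.
have I0 : (0 <= I)%E by apply: integral_ge0 => t _; rewrite lee_fin powR_ge0.
have J0 : (0 <= J)%E.
  by apply: integral_ge0 => t _; rewrite lee_fin mulr_ge0 ?powR_ge0.
have K0 : 0 < p * (beta + 1) `^ q by rewrite mulr_gt0 ?powR_gt0//; lra.
case: J J0 => [j| |]// _; last first.
  by move=> _; rewrite gt0_muley ?lte_fin ?divr_gt0// addey// leey.
case: I I0 => [i| |]// _; last by rewrite gt0_muley ?lte_fin.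
rewrite -!EFinM -!EFinD !lee_fin => h.
rewrite -(ler_pM2l D0).
apply: (le_trans (y := p * (beta + 1) `^ q * j - q * (beta + 1) * f `^ p)).
  by rewrite lerBrDr.
rewrite le_eqVlt; apply/orP; left; apply/eqP; field.
by rewrite gt_eqF.
Qed.

(** * The power functions and sharpness *)

(** The integrand may be unbounded at 0, so the fundamental theorem of
    calculus is applied on [x / (n + 2), x] and the segments exhaust
    (0, x]. *)
Lemma integral_powR (R : realType) (s x : R) : -1 < s -> 0 < x ->
  (\int[lebesgue_measure]_(t in `]0%R, x]) (t `^ s)%:E =
   (x `^ (s + 1) / (s + 1))%:E)%E.
Proof.
move=> s1 x0; have s10 : 0 < s + 1 by lra.
pose a n : R := x / n.+2%:R.
have a0 n : 0 < a n by rewrite divr_gt0 ?ltr0n.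
have ax n : a n < x by rewrite ltr_pdivrMr ?ltr0n// ltr_pMr// ltr1n.
have a_cvg : a @ \oo --> 0.
  rewrite -[X in _ --> X](mulr0 x); apply: cvgM; first exact: cvg_cst.
  by have := @cvg_harmonic R; rewrite -cvg_shiftS; exact.
have dP (t : R) : 0 < t ->
    is_derive t 1 (fun u : R => (s + 1)^-1 * u `^ (s + 1)) (t `^ s).
  move=> t0; have h := is_derive1_powR (s + 1) t0.
  by apply: is_derive_eq; rewrite /GRing.scale/= addrK mulKf// gt_eqF.
have cP (t : R) : 0 < t -> {for t, continuous (fun u : R => u `^ s)}.
  exact: continuous_powR.
have pos n t : t \in `[a n, x] -> 0 < t.
  by rewrite in_itv/= => /andP[/(lt_le_trans (a0 n))].
have Un : `]0, x]%classic = \bigcup_n `[a n, x]%classic :> set R.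
  apply/seteqP; split => [t /=|t [n _] /=]; rewrite !in_itv/=; last first.
    by move=> /andP[/(lt_le_trans (a0 n)) -> ->].
  move=> /andP[t0 tx].
  have [n _ Hn] : \forall n \near \oo, a n < t by exact: (cvgr_lt _ a_cvg).
  by exists n => //=; rewrite in_itv/= tx andbT ltW// Hn/=.
rewrite Un.
have nd : nondecreasing_seq (fun n => `[a n, x]%classic : set R).
  move=> m n mn; rewrite subsetEset; apply: subset_itvr; rewrite bnd_simp.
  by rewrite ler_pM2l// lef_pV2 ?posrE ?ltr0n// ler_nat.
have intE n : (\int[lebesgue_measure]_(t in `[a n, x]) (t `^ s)%:E =
    ((s + 1)^-1 * x `^ (s + 1) - (s + 1)^-1 * a n `^ (s + 1))%:E)%E.
  apply: (@FTC2_is_derive R (fun u : R => (s + 1)^-1 * u `^ (s + 1))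
    (fun u => u `^ s)) => //.
  - by move=> t /pos; exact: dP.
  - by move=> t /pos; exact: cP.
have h : (\int[lebesgue_measure]_(t in `[a n, x]) (t `^ s)%:E)%E @[n --> \oo] -->
    (\int[lebesgue_measure]_(t in \bigcup_n `[a n, x]%classic) (t `^ s)%:E)%E.
  apply: ge0_nondecreasing_set_cvg_integral => //.
  - by move=> n; apply/measurable_EFinP; apply: measurable_segment => t /pos; exact: cP.
  - by move=> n t _; rewrite lee_fin powR_ge0.
rewrite (funext intE) in h.
have h2 : ((s + 1)^-1 * x `^ (s + 1) - (s + 1)^-1 * a n `^ (s + 1))%:E @[n --> \oo]
    --> ((s + 1)^-1 * x `^ (s + 1) - (s + 1)^-1 * 0)%:E.
  apply: cvg_EFin; first exact: nearW.
  apply: cvgB; first exact: cvg_cst.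
  apply: cvgM; first exact: cvg_cst.
  have := powR_cvg0 s10 => /cvg_at_rightP; apply; split => //.
by rewrite -(cvg_lim _ h)// (cvg_lim _ h2)// mulr0 subr0 mulrC.
Qed.

Lemma powRV (R : realType) (x s : R) : 0 <= x -> x^-1 `^ s = (x `^ s)^-1.
Proof. by move=> x0; rewrite -powR_inv1// -powRrM mulN1r powRN. Qed.

Section power.
Variables (R : realType).
Implicit Types f b t p q : R.

(** Normalised so that the integral over (0, 1] is f; its average is b + 1
    times the function itself. *)
Definition power_extremal (f b t : R) : R := f / (b + 1) * t `^ (- (b / (b + 1))).

Lemma power_exponent_gtN1 b : 0 <= b -> -1 < - (b / (b + 1)).
Proof. by move=> b0; rewrite ltrN2 ltr_pdivrMr ?mul1r; lra. Qed.

Lemma integral_power_extremal f b x : 0 <= f -> 0 <= b -> 0 < x ->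
  (\int[lebesgue_measure]_(t in `]0%R, x]) (power_extremal f b t)%:E =
   (f * x `^ (1 - b / (b + 1)))%:E)%E.
Proof.
move=> f0 b0 x0; rewrite -ge0_integralZl_real//; last 3 first.
- by rewrite divr_ge0//; lra.
- by move=> t _; exact: powR_ge0.
- by apply: measurable_funTS; exact: measurable_powR.
rewrite integral_powR ?power_exponent_gtN1// -EFinM [- _ + 1]addrC; congr EFin.
set P := x `^ _.
by field; apply/andP; split; rewrite gt_eqF; lra.
Qed.

Lemma admissible_power_extremal f b : 0 < f -> 0 <= b ->
  admissible f (power_extremal f b).
Proof.
move=> f0 b0; have c0 : 0 <= f / (b + 1) by rewrite divr_ge0; lra.
split.
- by move=> t _; rewrite mulr_ge0 ?powR_ge0.
- move=> s t; rewrite !in_itv/= => /andP[s0 s1] /andP[t0 t1] st.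
  rewrite ler_wpM2l// !powRN lef_pV2 ?posrE ?powR_gt0//.
  apply: ge0_ler_powR; rewrite ?nnegrE ?(ltW s0) ?(ltW t0)//.
  by rewrite divr_ge0; lra.
- by rewrite (integral_power_extremal (ltW f0) b0)// powR1 mulr1.
Qed.

Lemma average_power_extremal f b t : 0 < f -> 0 <= b -> t \in `]0, 1] ->
  average (power_extremal f b) t = f * t `^ (- (b / (b + 1))).
Proof.
move=> f0 b0; rewrite in_itv/= => /andP[t0 t1].
rewrite /average /Rintegral (integral_power_extremal (ltW f0) b0)//=.
rewrite powRD; last by rewrite (gt_eqF t0) implybT.
by rewrite powRr1 ?ltW// mulrCA mulKf// gt_eqF.
Qed.

Lemma integral_power_powR f b p :
  0 < f -> 0 <= b -> 1 < p -> b * (p - 1) < 1 ->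
  (\int[lebesgue_measure]_(t in `]0%R, 1%R])
     (f `^ p * (t `^ (- (b / (b + 1)))) `^ p)%:E =
   (f `^ p * (b + 1) / (1 - b * (p - 1)))%:E)%E.
Proof.
move=> f0 b0 p1 bp.
under eq_integral do rewrite -powRrM.
rewrite -ge0_integralZl_real//; last 3 first.
- exact: powR_ge0.
- by move=> t _; exact: powR_ge0.
- by apply: measurable_funTS; exact: measurable_powR.
rewrite integral_powR//; last first.
  by rewrite mulNr ltrN2 mulrAC ltr_pdivrMr ?mul1r; lra.
rewrite powR1 -EFinM; congr EFin.
by field; apply/andP; split; rewrite gt_eqF; lra.
Qed.

(** Both integrands are multiples of the same power of t, since
    [power_extremal f b] is its own average divided by b + 1. *)
Lemma power_extremal_means f b p q : 0 < f -> 0 <= b -> 1 < p ->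
  b * (p - 1) < 1 ->
  (\int[lebesgue_measure]_(t in `]0%R, 1%R])
     (average (power_extremal f b) t `^ p)%:E =
   (f `^ p * (b + 1) / (1 - b * (p - 1)))%:E)%E /\
  (\int[lebesgue_measure]_(t in `]0%R, 1%R])
     (average (power_extremal f b) t `^ (p - q) * power_extremal f b t `^ q)%:E =
   (((b + 1) `^ q)^-1 * (f `^ p * (b + 1) / (1 - b * (p - 1))))%:E)%E.
Proof.
move=> f0 b0 p1 bp; rewrite [((_ `^ q)^-1 * _)%:E]EFinM.
rewrite -!(integral_power_powR f0 b0 p1 bp).
have b1 : 0 <= (b + 1)^-1 by rewrite invr_ge0; lra.
split.
  apply: eq_integral => t /[1!inE] t01.
  by rewrite average_power_extremal// powRM ?powR_ge0 ?ltW.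
rewrite ge0_integralZl_real//; last 3 first.
- by rewrite invr_ge0 powR_ge0.
- by move=> t _; rewrite mulr_ge0 ?powR_ge0.
- apply: measurable_funM => //; apply: (measurableT_comp (measurable_powR _)).
  by apply: measurable_funTS; exact: measurable_powR.
apply: eq_integral => t /[1!inE] t01; congr EFin.
have t0 : 0 < t by move: t01; rewrite /= in_itv/= => /andP[].
rewrite average_power_extremal// /power_extremal.
set s := - _; have ts : 0 < t `^ s by exact: powR_gt0.
have A0 : 0 < f * t `^ s by exact: mulr_gt0.
have -> : f / (b + 1) * t `^ s = (b + 1)^-1 * (f * t `^ s).
  by rewrite mulrA [_^-1 * f]mulrC.
rewrite -powRM; [|exact: ltW..]; rewrite (powRM q b1 (ltW A0)) mulrCA -powRD; last first.
  by rewrite (gt_eqF A0) implybT.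
rewrite subrK; congr (_ * _).
by rewrite powRV//; lra.
Qed.
End power.

(** The tangent bound at 1 / x gives x^q - 1 <= q x^q (1 - 1 / x), which is
    less than q x^q (x - 1); so it suffices that x^q <= r. *)
Lemma tangent_slope_lt (R : realType) (q beta r : R) :
  1 <= q -> 0 < beta -> 1 < r ->
  exists x, 1 < x <= beta + 1 /\ x `^ q - 1 < q * r * (x - 1).
Proof.
move=> q1 beta0 r1; have q0 : 0 < q by lra.
(* x <= beta + 1 ensures b >= 0 for b = (beta + 1) / x - 1 *)
pose x := Num.min (r `^ q^-1) (beta + 1).
have rq : 1 < r `^ q^-1.
  have := @gt0_ltr_powR R q^-1 _ 1 r; rewrite !nnegrE powR1 invr_gt0.
  by apply => //; lra.
have x1 : 1 < x by rewrite lt_min rq; lra.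
have xq : x `^ q <= r.
  have : x <= r `^ q^-1 by rewrite ge_min lexx.
  move/(ge0_ler_powR (ltW q0)); rewrite !nnegrE -powRrM mulVf ?gt_eqF// powRr1; last lra.
  by apply; rewrite ?powR_ge0//; lra.
exists x; split; first by rewrite x1 ge_min lexx orbT.
have xq0 : 0 < x `^ q by apply: powR_gt0; lra.
have xi : 0 <= x^-1 by rewrite invr_ge0; lra.
have := bernoulli_powR q1 xi; rewrite powRV; last lra.
rewrite -(ler_pM2l xq0) divff ?gt_eqF// => h.
have x0 : 0 < x by lra.
have E : 1 - x^-1 = (x - 1) / x by field; rewrite gt_eqF.
have : x `^ q - 1 <= q * (x `^ q * ((x - 1) / x)) by rewrite -E; move: (x^-1) h => z; lra.
move=> /le_lt_trans; apply; rewrite -mulrA ltr_pM2l//.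
apply: (@lt_le_trans _ _ (x `^ q * (x - 1))).
  by rewrite ltr_pM2l// ltr_pdivrMr// ltr_pMr; lra.
by rewrite ler_pM2r//; lra.
Qed.

(** After division by f^p both integrals of [power_extremal f b] are explicit
    and the claim is the inequality Hb about the parameter b alone. *)
Lemma hardy_sharp (R : realType) (p q beta f C : R) :
  1 < p -> 1 <= q <= p -> 0 < beta -> beta <= 1 / (p - 1) -> 0 < f ->
  C > q * (beta + 1) / ((p - 1) * q * beta + (p - q)) ->
  exists g : R -> R, admissible f g /\
    (\int[lebesgue_measure]_(t in `]0%R, 1%R]) (average g t `^ p)%:E
       > (- (C * f `^ p))%:E
         + (p * (beta + 1) `^ q / ((p - 1) * q * beta + (p - q)))%:E
           * \int[lebesgue_measure]_(t in `]0%R, 1%R])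
               (average g t `^ (p - q) * g t `^ q)%:E)%E.
Proof.
move=> p1 /andP[q1 qp] beta0 betap f0 HC.
have p10 : 0 < p - 1 by lra.
have D0 : 0 < (p - 1) * q * beta + (p - q) by rewrite ltr_pwDl ?mulr_gt0//; lra.
have fp0 : 0 < f `^ p by exact: powR_gt0.
have betap1 : beta * (p - 1) <= 1 by move: betap; rewrite ler_pdivlMr.
have [b [b0 bp Hb]] : exists b, [/\ 0 <= b, b * (p - 1) < 1 &
    p * (beta + 1) `^ q / ((p - 1) * q * beta + (p - q)) *
      (((b + 1) `^ q)^-1 * ((b + 1) / (1 - b * (p - 1))))
    < C + (b + 1) / (1 - b * (p - 1))].
  (* below the critical value the choice b = beta gives equality for the
     best constant; at the critical value b must stay below beta *)
  move: betap1; rewrite le_eqVlt => /predU1P[betap1|betap1]; last first.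
    exists beta; split => //; first exact: ltW.
    have Bq : 0 < (beta + 1) `^ q by apply: powR_gt0; lra.
    have e0 : 0 < 1 - beta * (p - 1) by lra.
    rewrite -ltrBlDr; apply: le_lt_trans HC; rewrite le_eqVlt; apply/orP; left.
    by apply/eqP; field; rewrite !gt_eqF.
  have Dp : (p - 1) * q * beta + (p - q) = p.
    by rewrite mulrAC (mulrC (p - 1)) betap1; lra.
  have r1 : 1 < C * (p - 1) / q.
    rewrite ltr_pdivlMr ?mul1r; last lra.
    move: HC; rewrite Dp ltr_pdivrMr; last lra.
    suff -> : q * (beta + 1) = q / (p - 1) * p.
      rewrite ltr_pM2r; last lra.
      by rewrite ltr_pdivrMr.
    have -> : q * (beta + 1) = q * (beta * (p - 1) + (p - 1)) / (p - 1).
      by field; rewrite gt_eqF.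
    by rewrite betap1; field; rewrite gt_eqF.
  have [x [/andP[x1 xb] Hx]] := tangent_slope_lt q1 beta0 r1.
  have x0 : 0 < x by lra.
  exists ((beta + 1) / x - 1).
  have pE : p - 1 = beta^-1.
    by apply: (mulfI (lt0r_neq0 beta0)); rewrite betap1 divff ?lt0r_neq0.
  have E1 : 1 - ((beta + 1) / x - 1) * (p - 1) = (beta + 1) * (p - 1) * (x - 1) / x.
    by rewrite pE; field; rewrite !gt_eqF.
  have b10 : 0 < beta + 1 by lra.
  split.
  - by rewrite subr_ge0 ler_pdivlMr ?mul1r.
  - by rewrite -subr_gt0 E1 divr_gt0// !mulr_gt0//; lra.
  rewrite E1 subrK Dp.
  have -> : (((beta + 1) / x) `^ q)^-1 = x `^ q / (beta + 1) `^ q.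
    rewrite powRM ?invr_ge0 ?ltW// powRV ?ltW// invfM invrK mulrC.
    by [].
  have Bq : 0 < (beta + 1) `^ q by apply: powR_gt0; lra.
  rewrite -ltrBlDr.
  have xm1 : 0 < x - 1 by lra.
  have -> : p * (beta + 1) `^ q / p * (x `^ q / (beta + 1) `^ q *
     ((beta + 1) / x / ((beta + 1) * (p - 1) * (x - 1) / x))) -
     (beta + 1) / x / ((beta + 1) * (p - 1) * (x - 1) / x) =
     (x `^ q - 1) / ((p - 1) * (x - 1)).
    by field; rewrite !gt_eqF//; lra.
  rewrite ltr_pdivrMr ?mulr_gt0//; apply: (lt_le_trans Hx).
  rewrite le_eqVlt; apply/orP; left; apply/eqP; field.
  by rewrite gt_eqF//; lra.
exists (power_extremal f b); split; first exact: admissible_power_extremal.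
have [-> ->] := power_extremal_means q f0 b0 p1 bp.
rewrite -EFinM -EFinD lte_fin.
set K := p * _ / _; rewrite -/K in Hb.
rewrite -(ltr_pM2l fp0) in Hb; move: Hb.
set w := (b + 1) / _ => h.
have -> : f `^ p * (b + 1) / (1 - b * (p - 1)) = f `^ p * w by rewrite mulrA.
move: h; set Q := ((b + 1) `^ q)^-1.
have alg (P K' Q' w' C' : R) : P * (K' * (Q' * w')) < P * (C' + w') ->
  - (C' * P) + K' * (Q' * (P * w')) < P * w' by lra.
exact: alg.
Qed.


Theorem corollary2 (R : realType) (p q : R) (hp : 1 < p) (hq : 1 <= q <= p) :
  (forall (f : R) (g : R -> R) (beta : R), admissible f g -> 0 < beta ->
    (\int[lebesgue_measure]_(t in `]0%R, 1%R]) (average g t `^ p)%:E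
     <= (- (q * (beta + 1) / ((p - 1) * q * beta + (p - q)) * f `^ p))%:E
        + (p * (beta + 1) `^ q / ((p - 1) * q * beta + (p - q)))%:E
          * \int[lebesgue_measure]_(t in `]0%R, 1%R])
              (average g t `^ (p - q) * g t `^ q)%:E)%E)
  /\
  (forall beta f C : R, 0 < beta -> beta <= 1 / (p - 1) -> 0 < f ->
    C > q * (beta + 1) / ((p - 1) * q * beta + (p - q)) ->
    exists g : R -> R, admissible f g /\
      (\int[lebesgue_measure]_(t in `]0%R, 1%R]) (average g t `^ p)%:E
       > (- (C * f `^ p))%:E
         + (p * (beta + 1) `^ q / ((p - 1) * q * beta + (p - q)))%:E
           * \int[lebesgue_measure]_(t in `]0%R, 1%R])
               (average g t `^ (p - q) * g t `^ q)%:E)%E).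
Proof.
split.
- by move=> f g beta fg beta0; exact: hardy_inequality.
- by move=> beta f C; exact: hardy_sharp.
Qed.
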